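(* Let $r$ be an integer. The Fuss-Catalan matrix $(g_r(x),g_r(x))$, i.e. the infinite matrix whose $(n,k)$ entry is $[x^n]\,g_r(x)^{k+1}$ for $n,k\ge 0$, is equal to the matrix product $M\,\mathbf{B}^T$, where $M$ is the Riordan array $$M=(g_r(x),\,x\,g_r(x)^r)=\left(\frac{1}{1+x},\,\frac{x}{(1+x)^r}\right)^{-1}$$ and $\mathbf{B}^T$ is the transpose of the binomial matrix $\mathbf{B}=\left(\binom{n}{k}\right)_{n,k\ge 0}$.
   Context: $g_r(x)\in\mathbb{Q}[[x]]$ is the unique formal power series with constant term $1$ satisfying $g_r(x)=1+x\,g_r(x)^r$. A Riordan array is a pair $(g(x),f(x))$ of formal power series with $g(0)\neq 0$, $f(0)=0$, $f'(0)\neq 0$, identified with the infinite lower-triangular matrix with entries $t_{n,k}=[x^n]\,g(x)f(x)^k$, $n,k\ge0$; the inverse is $(g,f)^{-1}=\left(\frac{1}{g(\bar f(x))},\bar f(x)\right)$, where $\bar f$ is the compositional inverse of $f$, and corresponds to the matrix inverse. The rectification of a Riordan array $(g(x),f(x))$, denoted $\left(g(x),\frac{f(x)}{x}\right)$, is the (square, not triangular) infinite matrix with bivariate generating function $\frac{g(x)}{1-y f(x)/x}$, i.e. with $(n,k)$ entry $[x^n]\,g(x)\left(\frac{f(x)}{x}\right)^k$. The Fuss-Catalan matrix $(g_r(x),g_r(x))$ is the rectification of the Riordan array $(g_r(x),x\,g_r(x))$. The product $M\mathbf{B}^T$ is well defined because $M$ is lower-triangular. *)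

(* Defs.v *)
From HB Require Import structures.
From mathcomp Require Import all_boot all_order all_algebra.
From mathcomp Require Import boolp classical_sets functions cardinality fsbigop.

Set Implicit Arguments.
Unset Strict Implicit.
Unset Printing Implicit Defensive.

Import Order.TTheory GRing.Theory Num.Theory.
Local Open Scope ring_scope.

(* A one-field record rather than the bare arrow type [nat -> F], which already
   carries the pointwise product.  With the coercion, [f n] is [x^n] f(x). *)
Record fps (F : fieldType) := Fps { fps_coef :> nat -> F }.

HB.instance Definition _ (F : fieldType) := gen_eqMixin (fps F).
HB.instance Definition _ (F : fieldType) := gen_choiceMixin (fps F).

(* Locked, as unfolding them during unification is very expensive. *)
HB.lock Definition fps_add (F : fieldType) (f g : fps F) : fps F :=
  Fps (fun n => f n + g n).
Canonical fps_add_unlockable := Unlockable fps_add.unlock.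
HB.lock Definition fps_mul (F : fieldType) (f g : fps F) : fps F :=
  Fps (fun n => \sum_(i < n.+1) f i * g (n - i)%N).
Canonical fps_mul_unlockable := Unlockable fps_mul.unlock.

Section FpsRing.
Variable F : fieldType.
Implicit Types (f g h : fps F) (n : nat).

Lemma fpsP f g : (forall n, f n = g n) <-> f = g.
Proof.
split=> [|-> //]; case: f g => [f] [g] /= fg; congr Fps; exact: funext.
Qed.

Definition fpsC (c : F) : fps F := Fps (fun n => if n == 0%N then c else 0).
Definition fpsX : fps F := Fps (fun n => (n == 1)%:R).
Definition fps_opp f : fps F := Fps (fun n => - f n).

Let coefD f g n : fps_add f g n = f n + g n. Proof. by rewrite unlock. Qed.
Let coefM f g n : fps_mul f g n = \sum_(i < n.+1) f i * g (n - i)%N.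
Proof. by rewrite unlock. Qed.

Let addA : associative (@fps_add F).
Proof. by move=> f g h; apply/fpsP => n; rewrite !coefD addrA. Qed.
Let addC : commutative (@fps_add F).
Proof. by move=> f g; apply/fpsP => n; rewrite !coefD addrC. Qed.
Let add0 : left_id (fpsC 0) (@fps_add F).
Proof.
by move=> f; apply/fpsP => n; rewrite coefD /=; case: ifP; rewrite add0r.
Qed.
Let addN : left_inverse (fpsC 0) fps_opp (@fps_add F).
Proof.
by move=> f; apply/fpsP => n; rewrite coefD /=; case: ifP; rewrite addNr.
Qed.

HB.instance Definition _ := GRing.isZmodule.Build (fps F) addA addC add0 addN.

Let trunc N f : {poly F} := \poly_(i < N) f i.

Let mul_trunc N f g n : (n < N)%N ->
  fps_mul f g n = (trunc N f * trunc N g)`_n.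
Proof.
move=> nN; rewrite coefM poly.coefM; apply: eq_bigr => i _; rewrite !coef_poly.
by rewrite (leq_ltn_trans _ nN) ?(leq_ltn_trans (leq_subr _ _) nN) // -ltnS.
Qed.

Let mulC : commutative (@fps_mul F).
Proof.
by move=> f g; apply/fpsP => n; rewrite !(mul_trunc _ _ (ltnSn n)) mulrC.
Qed.
Let mulA : associative (@fps_mul F).
Proof.
move=> f g h; apply/fpsP => n.
transitivity ((trunc n.+1 f * (trunc n.+1 g * trunc n.+1 h))`_n).
  rewrite coefM poly.coefM; apply: eq_bigr => i _.
  by rewrite coef_poly ltn_ord (@mul_trunc n.+1) // ltnS leq_subr.
rewrite mulrA coefM poly.coefM; apply: eq_bigr => i _.
by rewrite coef_poly ltnS leq_subr (@mul_trunc n.+1).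
Qed.
Let mul1 : left_id (fpsC 1) (@fps_mul F).
Proof.
move=> f; apply/fpsP => n; rewrite coefM.
by rewrite big_ord_recl mul1r subn0 big1 ?addr0 // => i _; rewrite mul0r.
Qed.
Let mulD : left_distributive (@fps_mul F) (@fps_add F).
Proof.
move=> f g h; apply/fpsP => n; rewrite coefD !coefM -big_split.
by apply: eq_bigr => i _; rewrite coefD mulrDl.
Qed.
Let one_neq0 : fpsC 1 != 0 :> fps F.
Proof. by apply/eqP => /fpsP/(_ 0%N)/eqP; rewrite /= oner_eq0. Qed.

HB.instance Definition _ :=
  GRing.Zmodule_isComNzRing.Build (fps F) mulA mulC mul1 mulD one_neq0.

Lemma fps_coef0 n : (0 : fps F) n = 0. Proof. by rewrite /=; case: ifP. Qed.
Lemma fps_coef1 n : (1 : fps F) n = (n == 0)%:R.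
Proof. by rewrite /=; case: ifP. Qed.
Lemma fps_coefN f n : (- f) n = - f n. Proof. by []. Qed.
Lemma fps_coefD f g n : (f + g) n = f n + g n. Proof. exact: coefD. Qed.
Lemma fps_coefB f g n : (f - g) n = f n - g n. Proof. exact: coefD. Qed.
Lemma fps_coefM f g n : (f * g) n = \sum_(i < n.+1) f i * g (n - i)%N.
Proof. exact: coefM. Qed.
Lemma fps_coefM0 f g : (f * g) 0%N = f 0%N * g 0%N.
Proof. by rewrite fps_coefM big_ord1. Qed.
Lemma fps_coefCM c f n : (fpsC c * f) n = c * f n.
Proof.
rewrite fps_coefM big_ord_recl subn0 big1 ?addr0 // => i _.
by rewrite /= mul0r.
Qed.
Lemma fps_coefXM f n : (fpsX * f) n = if n is m.+1 then f m else 0.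
Proof.
rewrite fps_coefM big_ord_recl /= mul0r add0r.
case: n => [|n]; first by rewrite big_ord0.
rewrite big_ord_recl /= mul1r subSS subn0 big1 ?addr0 // => i _.
by rewrite mul0r.
Qed.
Lemma fps_coef_sum (I : Type) (s : seq I) (P : pred I) (G : I -> fps F) n :
  (\sum_(i <- s | P i) G i) n = \sum_(i <- s | P i) G i n.
Proof.
elim/big_rec2: _ => [|i x y _ <-]; [exact: fps_coef0 | exact: fps_coefD].
Qed.
Lemma fps_coefX_small f n k : f 0%N = 0 -> (n < k)%N -> (f ^+ k) n = 0.
Proof.
move=> f0; elim: k n => // k IHk n nk.
rewrite exprS fps_coefM big1 // => i _.
have [i0|i_gt0] := posnP i; first by rewrite i0 f0 mul0r.
rewrite IHk ?mulr0 // -ltnS (leq_trans _ nk) // ltnS ltn_subrL i_gt0.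
by rewrite (leq_trans i_gt0) // -ltnS.
Qed.

Definition fps_unit : {pred fps F} := fun f => f 0%N != 0.

(* 1/f = f(0)^-1 * sum_k (1 - f/f(0))^k; only k <= n contribute to x^n. *)
Definition fps_inv f : fps F :=
  if f 0%N != 0 then
    Fps (fun n => \sum_(k < n.+1)
                    (f 0%N)^-1 * ((1 - fpsC (f 0%N)^-1 * f) ^+ k) n)
  else f.

Let mulV : {in fps_unit, left_inverse 1 fps_inv *%R}.
Proof.
move=> f f0; have {}f0 : f 0%N != 0 by [].
set u := 1 - fpsC (f 0%N)^-1 * f.
have u0 : u 0%N = 0.
  by rewrite fps_coefB fps_coef1 fps_coefCM mulVf // subrr.
have fE : f = fpsC (f 0%N) * (1 - u).
  rewrite opprB addrC subrK; apply/fpsP => n.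
  by rewrite !fps_coefCM mulrA mulfV // mul1r.
apply/fpsP => n.
transitivity ((fpsC (f 0%N)^-1 * (\sum_(k < n.+1) u ^+ k) * f) n).
  rewrite [LHS]fps_coefM [RHS]fps_coefM; apply: eq_bigr => i _.
  congr (_ * _); rewrite [RHS]fps_coefCM fps_coef_sum mulr_sumr.
  rewrite /fps_inv f0 /= -/u.
  rewrite (big_ord_widen _ (fun k => (f 0%N)^-1 * (u ^+ k) i) (ltn_ord i)).
  rewrite [RHS](bigID (fun k : 'I_n.+1 => (k < i.+1)%N)) /=.
  rewrite [X in _ + X]big1 ?addr0 // => k; rewrite -leqNgt => ik.
  by rewrite fps_coefX_small // mulr0.
rewrite [X in _ * X]fE mulrACA.
have -> : fpsC (f 0%N)^-1 * fpsC (f 0%N) = 1.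
  apply/fpsP => m; rewrite fps_coefCM fps_coef1 /=.
  by case: ifP; rewrite ?mulr0 // mulVf.
rewrite mul1r mulrC -opprB mulNr -subrX1 opprB fps_coefB.
by rewrite (fps_coefX_small (n := n)) // subr0.
Qed.
Let unitPl f g : g * f = 1 -> fps_unit f.
Proof.
move=> gf1; apply/negP => /eqP f0.
have /eqP := fps_coef1 0; rewrite -gf1 fps_coefM0 f0 mulr0.
by rewrite eq_sym oner_eq0.
Qed.
Let invr_out : {in [predC fps_unit], fps_inv =1 id}.
Proof. by move=> f /negPf f0; rewrite /fps_inv [_ != _]f0. Qed.

HB.instance Definition _ :=
  GRing.ComNzRing_hasMulInverse.Build (fps F) mulV unitPl invr_out.

Lemma fps_unitE f : (f \is a GRing.unit) = (f 0%N != 0). Proof. by []. Qed.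

(* g(f(x)), meaningful when f(0) = 0: then f^k has no x^n term for k > n. *)
Definition fps_comp g f : fps F :=
  Fps (fun n => \sum_(k < n.+1) g k * (f ^+ k) n).

Definition is_compinv f h :=
  [/\ h 0%N = 0, fps_comp f h = fpsX & fps_comp h f = fpsX].

(* The compositional inverse of f, or the junk value 0 if there is none. *)
Definition compinv f : fps F := xget 0 [set h | is_compinv f h].

End FpsRing.

Arguments fpsX {F}.

Definition imatrix := nat -> nat -> rat.

(* [\sum_(j \in setT)] is the library's sum of a finitely supported family
   (0 if the support is infinite). *)
Definition imulmx (A B : imatrix) : imatrix :=
  fun n k => \sum_(j \in [set: nat]) A n j * B j k.

Definition itrmx (A : imatrix) : imatrix := fun n k => A k n.

Definition lower_triangular (A : imatrix) := forall n k, (n < k)%N -> A n k = 0.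

Lemma imulmx_lower (A B : imatrix) n k : lower_triangular A ->
  imulmx A B n k = \sum_(j < n.+1) A n j * B j k.
Proof.
move=> lowA; rewrite /imulmx (fsbig_ord _ _ (fun j => A n j * B j k)).
symmetry; apply: fsbig_widen => // j [_ /= /negP]; rewrite -leqNgt => nj.
by rewrite lowA ?mul0r.
Qed.

Definition is_riordan (A : fps rat * fps rat) :=
  [/\ A.1 0%N != 0, A.2 0%N = 0 & A.2 1%N != 0].

Definition riordan_mx (A : fps rat * fps rat) : imatrix :=
  fun n k => (A.1 * A.2 ^+ k) n.

Lemma riordan_mx_lower A : is_riordan A -> lower_triangular (riordan_mx A).
Proof.
case=> _ f0 _ n k nk; rewrite /riordan_mx fps_coefM big1 // => i _.
by rewrite fps_coefX_small ?mulr0 // (leq_ltn_trans (leq_subr _ _)).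
Qed.

Definition riordan_inv (A : fps rat * fps rat) : fps rat * fps rat :=
  ((fps_comp A.1 (compinv A.2))^-1, compinv A.2).

(* f(x)/x when f(0) = 0. *)
Definition fps_divX (f : fps rat) : fps rat := Fps (fun n => f n.+1).

Definition rectification_mx (A : fps rat * fps rat) : imatrix :=
  fun n k => (A.1 * fps_divX A.2 ^+ k) n.

Definition binomial_mx : imatrix := fun n k => 'C(n, k)%:R.

(* Here [g ^ r] is the integer power, so r may be zero or negative. *)
Definition is_fuss_catalan (r : int) (g : fps rat) :=
  g 0%N = 1 /\ g = 1 + fpsX * g ^ r.

Definition fuss_catalan (r : int) : fps rat :=
  xget 0 [set g | is_fuss_catalan r g].

Section FussCatalanExists.
Variables (F : fieldType) (r : int).
Implicit Types (g h : fps F) (n : nat).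

Let eqm n g h := forall i, (i < n)%N -> g i = h i.

Let eqm_mul n g h g' h' : eqm n g h -> eqm n g' h' -> eqm n (g * g') (h * h').
Proof.
move=> gh gh' i ilt; rewrite !fps_coefM; apply: eq_bigr => j _.
by rewrite gh ?gh' // (leq_ltn_trans _ ilt) ?leq_subr // -ltnS.
Qed.

Let eqm_exp n g h k : eqm n g h -> eqm n (g ^+ k) (h ^+ k).
Proof. by move=> gh; elim: k => // k IHk; rewrite !exprS; apply: eqm_mul. Qed.

Let exp0 g k : g 0%N = 1 -> (g ^+ k) 0%N = 1.
Proof.
move=> g0; elim: k => [|k IHk]; first exact: fps_coef1.
by rewrite exprS fps_coefM0 g0 IHk mulr1.
Qed.

Let eqm_inv n g h : g 0%N = 1 -> h 0%N = 1 -> eqm n g h -> eqm n g^-1 h^-1.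
Proof.
move=> g0 h0 gh.
have Ug : g \is a GRing.unit by rewrite fps_unitE g0 oner_eq0.
have Uh : h \is a GRing.unit by rewrite fps_unitE h0 oner_eq0.
have hE : h^-1 = g * (g^-1 * h^-1) by rewrite mulrA mulrV ?mul1r.
have gE : g^-1 = h * (g^-1 * h^-1) by rewrite mulrCA mulrV ?mulr1.
by rewrite hE [X in eqm n X]gE; apply: eqm_mul => // i ilt; rewrite gh.
Qed.

Let eqm_expz n g h :
  g 0%N = 1 -> h 0%N = 1 -> eqm n g h -> eqm n (g ^ r) (h ^ r).
Proof.
move=> g0 h0 gh; case: r => k; first exact: eqm_exp.
by apply: eqm_inv; [exact: exp0 | exact: exp0 | exact: eqm_exp].
Qed.

Let fixpoint (phi : fps F -> fps F) :
  (forall g, phi g 0%N = 1) ->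
  (forall n g h,
     g 0%N = 1 -> h 0%N = 1 -> eqm n g h -> eqm n.+1 (phi g) (phi h)) ->
  exists! g, g 0%N = 1 /\ g = phi g.
Proof.
move=> phi0 phiS; pose it n := iter n phi 1.
have it0 n : it n 0%N = 1 by case: n => [|n]; [exact: fps_coef1 | exact: phi0].
have itS n : eqm n (it n) (it n.+1).
  by elim: n => // n IHn; exact: (phiS _ _ _ (it0 n) (it0 n.+1) IHn).
have it_stable m n : (n <= m)%N -> eqm n (it n) (it m).
  move=> /subnKC <-; elim: (m - n)%N => [|d IHd]; first by rewrite addn0.
  move=> i ilt; rewrite addnS IHd // itS //.
  exact: leq_trans ilt (leq_addr _ _).
pose g : fps F := Fps (fun n => it n.+1 n).
have g0 : g 0%N = 1 by exact: phi0.
have git n : eqm n g (it n) by move=> i ilt; exact: it_stable.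
have gphi : g = phi g.
  apply/fpsP => n; symmetry.
  exact: (phiS _ _ _ g0 (it0 n) (git n)).
exists g; split=> // h [h0 hE]; apply/fpsP => n.
suff gh m : eqm m g h by exact: (gh n.+1).
elim: m => // m IHm; rewrite gphi hE; exact: phiS.
Qed.

Lemma fuss_catalan_exists_unique_field :
  exists! g, g 0%N = 1 /\ g = 1 + fpsX * g ^ r.
Proof.
have step0 g : (1 + fpsX * g ^ r) 0%N = 1.
  by rewrite fps_coefD fps_coef1 fps_coefXM addr0.
have stepS g n : (1 + fpsX * g ^ r) n.+1 = (g ^ r) n.
  by rewrite fps_coefD fps_coef1 fps_coefXM add0r.
apply: fixpoint => // n g h g0 h0 gh [_|i ilt]; first by rewrite !step0.
by rewrite !stepS; exact: (eqm_expz g0 h0 gh).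
Qed.

End FussCatalanExists.

Lemma fuss_catalan_exists_unique r : exists! g, is_fuss_catalan r g.
Proof. exact: fuss_catalan_exists_unique_field. Qed.

Lemma fuss_catalanP r : is_fuss_catalan r (fuss_catalan r).
Proof.
have [g [Pg _]] := fuss_catalan_exists_unique r.
by apply: (@xgetPex _ 0 [set g | is_fuss_catalan r g]); exists g.
Qed.

Definition fuss_catalan_mx (r : int) : imatrix :=
  fun n k => (fuss_catalan r ^+ k.+1) n.

Lemma fuss_catalan_mx_rectification r :
  fuss_catalan_mx r = rectification_mx (fuss_catalan r, fpsX * fuss_catalan r).
Proof.
have divXK : fps_divX (fpsX * fuss_catalan r) = fuss_catalan r.
  by apply/fpsP => m; exact: fps_coefXM.
apply/funext => n; apply/funext => k.
by rewrite /fuss_catalan_mx exprS /rectification_mx [in RHS]divXK.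
Qed.

(* Main.v *)
(** Substituting a series f with f(0) = 0 is a ring morphism sending x to f.
    Let f = x / (1 + x)^r and h = x g^r = g - 1.  A series h' with h'(0) = 0
    satisfies f(h') = x iff 1 + h' solves the equation of g, so h is the only
    right inverse of f.  It is also a left inverse: v = g(f) / (1 + x) satisfies
    v (1 + x) = 1 + x v^r, hence v = 1 and h(f) = g(f) - 1 = x.  The entries then
    follow from g^(k+1) = g (1 + x g^r)^k by the binomial theorem. *)
Require Import Defs.
From HB Require Import structures.
From mathcomp Require Import all_boot all_order all_algebra.
From mathcomp Require Import boolp classical_sets functions cardinality fsbigop.

Import Order.TTheory GRing.Theory Num.Theory.
Local Open Scope ring_scope.

(** Geometric sum; a negative power reduces to a positive one through
    [v^-m - 1 = -(v^m - 1) / v^m]. *)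
Lemma subr1_dvd_exprz (R : comUnitRingType) (v : R) (r : int) :
  v \is a GRing.unit -> exists s, v ^ r - 1 = (v - 1) * s.
Proof.
move=> Uv; case: r => k; first by exists (\sum_(i < k) v ^+ i); rewrite -subrX1.
exists (- (\sum_(i < k.+1) v ^+ i) / v ^+ k.+1).
rewrite mulrA mulrN -subrX1 opprB mulrBl mul1r.
by rewrite mulrV ?unitrX // NegzE -exprnN.
Qed.

Lemma sum_ord_widen (V : nmodType) (m N : nat) (t : nat -> V) :
  (m <= N)%N -> (forall j, (m <= j)%N -> t j = 0) ->
  \sum_(j < m) t j = \sum_(j < N) t j.
Proof.
move=> mN t0; rewrite -!(big_mkord xpredT) [RHS](big_cat_nat (n := m)) //=.
rewrite [X in _ = _ + X]big_nat [X in _ = _ + X]big1 ?addr0 //.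
by move=> j /andP[/t0].
Qed.

Section Composition.
Variable F : fieldType.
Implicit Types (f g h : fps F) (n : nat).

Lemma fps_coef_comp n f g :
  fps_comp g f n = \sum_(k < n.+1) g k * (f ^+ k) n.
Proof. by []. Qed.

(** Lets coefficients of different degrees share one cut-off, so that their sums can be
    exchanged. *)
Lemma fps_comp_widen N n f g : f 0%N = 0 -> (n < N)%N ->
  fps_comp g f n = \sum_(k < N) g k * (f ^+ k) n.
Proof.
move=> f0 nN.
apply: (sum_ord_widen _ _ _ (fun k => g k * (f ^+ k) n)) => // k nk.
by rewrite fps_coefX_small ?mulr0.
Qed.

Lemma fps_compB f g h : fps_comp (g - h) f = fps_comp g f - fps_comp h f.
Proof.
apply/fpsP => n; rewrite fps_coefB !fps_coef_comp -sumrB.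
by apply: eq_bigr => k _; rewrite fps_coefB mulrBl.
Qed.

Lemma fps_comp1 f : fps_comp 1 f = 1.
Proof.
apply/fpsP => n; rewrite fps_coef_comp big_ord_recl fps_coef1 mul1r.
by rewrite big1 ?addr0 // => k _; rewrite fps_coef1 mul0r.
Qed.

Lemma fps_compX f : f 0%N = 0 -> fps_comp fpsX f = f.
Proof.
move=> f0; apply/fpsP => n; rewrite (fps_comp_widen n.+2) //.
rewrite !big_ord_recl /= mul0r add0r mul1r expr1.
by rewrite big1 ?addr0 // => k _; rewrite mul0r.
Qed.

Lemma fps_comp_coef0 f g : fps_comp g f 0%N = g 0%N.
Proof. by rewrite fps_coef_comp big_ord1 expr0 fps_coef1 mulr1. Qed.

(** Both sides are brought to the sum of [g i * h j * (f ^+ (i + j)) n] over the square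
    [i, j <= n]. *)
Lemma fps_compM f g h : f 0%N = 0 ->
  fps_comp (g * h) f = fps_comp g f * fps_comp h f.
Proof.
move=> f0; apply/fpsP => n.
transitivity (\sum_(i < n.+1) \sum_(j < n.+1) g i * h j * (f ^+ (i + j)) n).
  (* The Cauchy product is indexed by [k = i + j]; after the exchange of sums, [k] is shifted by
     [i]. *)
  transitivity (\sum_(k < n.+1) \sum_(i < n.+1 | (i <= k)%N)
                  g i * h (k - i)%N * (f ^+ k) n).
    apply: eq_bigr => k _; rewrite fps_coefM mulr_suml.
    by rewrite (big_ord_widen n.+1
      (fun i => g i * h (k - i)%N * (f ^+ k) n)).
  rewrite (exchange_big_dep xpredT) //=; apply: eq_bigr => i _.
  rewrite -(big_mkord (fun k => i <= k)%N
             (fun k => g i * h (k - i)%N * (f ^+ k) n)).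
  rewrite (big_cat_nat (n := i)) //=; last exact: ltnW.
  rewrite big_nat_cond big1 ?add0r; last first.
    by move=> k /andP[/andP[_ ki]]; rewrite leqNgt ki.
  rewrite -{1}[i : nat]add0n big_addn.
  rewrite (eq_big xpredT (fun j => g i * h j * (f ^+ (i + j)) n)); first last.
  - by move=> j _; rewrite addnK addnC.
  - by move=> j; rewrite leq_addl.
  (* The triangle [i + j <= n] fills up to the square: beyond it, [f ^+ (i + j)] has no term of
     degree [n]. *)
  rewrite big_mkord; apply: (sum_ord_widen _ _ _
    (fun j => g i * h j * (f ^+ (i + j)) n)); first exact: leq_subr.
  by move=> j ij; rewrite fps_coefX_small ?mulr0 // -leq_subLR.
transitivity (\sum_(m < n.+1) \sum_(i < n.+1) \sum_(j < n.+1)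
                g i * h j * ((f ^+ i) m * (f ^+ j) (n - m)%N)).
  rewrite [RHS]exchange_big; apply: eq_bigr => i _.
  rewrite [RHS]exchange_big; apply: eq_bigr => j _.
  by rewrite exprD fps_coefM mulr_sumr.
rewrite fps_coefM; apply: eq_bigr => m _.
rewrite (fps_comp_widen n.+1) // (fps_comp_widen n.+1) ?ltnS ?leq_subr //.
rewrite mulr_suml; apply: eq_bigr => i _; rewrite mulr_sumr.
by apply: eq_bigr => j _; rewrite mulrACA.
Qed.

(* The unused proof argument lets substitution carry a ring morphism instance,
   which it only has for f(0) = 0. *)
Definition fps_subst f (f0 : f 0%N = 0) g := fps_comp g f.

HB.instance Definition _ f (f0 : f 0%N = 0) :=
  GRing.isZmodMorphism.Build (fps F) (fps F) (fps_subst f f0) (fps_compB f).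
HB.instance Definition _ f (f0 : f 0%N = 0) :=
  GRing.isMonoidMorphism.Build (fps F) (fps F) (fps_subst f f0)
    (conj (fps_comp1 f) (fun g h => fps_compM f g h f0)).

Lemma fps_unit1X h : h 0%N = 0 -> 1 + h \is a GRing.unit.
Proof. by move=> h0; rewrite fps_unitE fps_coefD h0 addr0 oner_eq0. Qed.

Lemma fps_comp_divXz f (r : int) : f 0%N = 0 ->
  fps_comp (fpsX / (1 + fpsX) ^ r) f = f / (1 + f) ^ r.
Proof.
move=> f0; have UX : 1 + fpsX \is a @GRing.unit (fps F) by exact: fps_unit1X.
rewrite -[LHS]/(fps_subst f f0 _) rmorphM rmorphV ?unitrXz // rmorphXz //.
by rewrite rmorphD rmorph1 /= /fps_subst fps_compX.
Qed.

(** In the form [v - 1 = x v (v^(r-1) - 1)], the equation makes [v - 1] equal to itself times a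
    series with zero constant term. *)
Lemma fps_fixpoint_eq1 (v : fps F) (r : int) : v \is a GRing.unit ->
  v * (1 + fpsX) = 1 + fpsX * v ^ r -> v = 1.
Proof.
move=> Uv vE; have [s sE] := subr1_dvd_exprz _ v (r - 1) Uv.
(* The equation says that (v - 1) (1 - x v s) = 0. *)
have Us : 1 - fpsX * (v * s) \is a GRing.unit.
  by rewrite fps_unitE fps_coefB fps_coef1 fps_coefXM subr0 oner_eq0.
apply/eqP; rewrite -subr_eq0 -(mulIr_eq0 _ (mulIr Us)) mulrBr mulr1.
have vE' : v * v ^ (r - 1) = v ^ r.
  by rewrite -{1}[v]expr1z -exprzDr // addrC subrK.
have -> : (v - 1) * (fpsX * (v * s)) = fpsX * v ^ r - fpsX * v.
  by rewrite mulrCA [_ * (v * s)]mulrCA -sE !mulrBr mulr1 vE'.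
rewrite subr_eq0 subr_eq addrAC [_ + 1]addrC -vE.
by rewrite mulrDr mulr1 [v * _]mulrC addrK.
Qed.

End Composition.

Lemma fuss_catalan_compinv (r : int) :
  compinv (fpsX / (1 + fpsX) ^ r) = fpsX * fuss_catalan r ^ r.
Proof.
have [] := fuss_catalanP r; set g := fuss_catalan r => g0 gE.
have Ug : g \is a GRing.unit by rewrite fps_unitE g0 oner_eq0.
set f : fps rat := fpsX / _; set h := fpsX * g ^ r.
have h0 : h 0%N = 0 by rewrite fps_coefXM.
have f0 : f 0%N = 0 by rewrite fps_coefXM.
have UX : 1 + fpsX \is a @GRing.unit (fps rat) by exact: fps_unit1X.
apply: xget_unique => [|h' [h'0 fh' _]].
  split=> //; first by rewrite fps_comp_divXz // -gE mulrK ?unitrXz.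
  set w := fps_comp g f.
  have wE : w = 1 + fps_comp h f.
    by rewrite -[LHS]/(fps_subst _ f f0 g) {1}gE rmorphD rmorph1.
  have Uw : w \is a GRing.unit by rewrite fps_unitE fps_comp_coef0.
  have hf : fps_comp h f = f * w ^ r.
    by rewrite -[LHS]/(fps_subst _ f f0 _) rmorphM rmorphXz //=
               /fps_subst fps_compX.
  (* Adding 1 turns the goal into [w = 1 + fpsX], that is [w / (1 + fpsX) = 1]. *)
  apply: (@addrI _ 1); rewrite -wE -[RHS]mul1r.
  rewrite -[LHS](divrK UX); congr (_ * _).
  apply: (@fps_fixpoint_eq1 _ _ r); first by rewrite unitrMl ?unitrV.
  (* Here [f * w ^ r] is [fpsX * (w / (1 + fpsX)) ^ r], so [wE] is the required equation. *)
  rewrite divrK // {1}wE hf exprMz_comm ?unitrV //; last exact: mulrC.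
  by rewrite exprz_inv -invr_expz mulrA mulrAC.
have h'E : h' = fpsX * (1 + h') ^ r.
  by rewrite -fh' fps_comp_divXz // divrK ?unitrXz ?fps_unit1X.
have [G [_ Guniq]] := fuss_catalan_exists_unique r.
have gh' : g = 1 + h'.
  rewrite -(Guniq g) ?(Guniq (1 + h')) //.
  by split; [rewrite fps_coefD h'0 fps_coef1 addr0 | rewrite {1}h'E].
by rewrite /h gh' -h'E.
Qed.

Lemma fuss_catalan_mxE (r : int) (n k : nat) :
  fuss_catalan_mx r n k =
  \sum_(j < n.+1)
    riordan_mx (fuss_catalan r, fpsX * fuss_catalan r ^ r) n j * 'C(k, j)%:R.
Proof.
rewrite /fuss_catalan_mx /riordan_mx /=.
have [] := fuss_catalanP r; set g := fuss_catalan r => g0 gE.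
set h := fpsX * g ^ r.
have h0 : h 0%N = 0 by rewrite fps_coefXM.
pose t j := (g * h ^+ j) n * 'C(k, j)%:R.
have -> : (g ^+ k.+1) n = \sum_(j < k.+1) t j.
  rewrite exprS [in X in _ * X]gE -/h exprDn mulr_sumr fps_coef_sum.
  apply: eq_bigr => j _; rewrite expr1n mul1r mulrnAr /t mulr_natr.
  (* Taking a coefficient commutes with natural multiples. *)
  by elim: 'C(k, j) => [|m IHm]; rewrite ?mulr0n ?fps_coef0 //
    !mulrS fps_coefD IHm.
(* The binomial sum stops at [k], the matrix product at [n]. Both extend to a common bound:
   ['C(k, j)] vanishes for [j > k], and [h ^+ j] starts in degree at least [j]. *)
rewrite (sum_ord_widen _ _ (maxn k.+1 n.+1) t) ?leq_maxl //; last first.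
  by move=> j kj; rewrite /t bin_small ?mulr0.
symmetry; apply: (sum_ord_widen _ _ _ t) => [|j nj]; first exact: leq_maxr.
rewrite /t fps_coefM big1 ?mul0r // => i _.
by rewrite fps_coefX_small ?mulr0 // (leq_ltn_trans (leq_subr _ _)).
Qed.

Theorem proposition17 (r : int) :
  let g := fuss_catalan r in
  let M := (g, fpsX * g ^ r) in
  let N := ((1 + fpsX)^-1, fpsX / (1 + fpsX) ^ r) in
  [/\ is_riordan M,
      is_riordan N,
      M = riordan_inv N &
      fuss_catalan_mx r = imulmx (riordan_mx M) (itrmx binomial_mx)].
Proof.
move=> g M N; have [g0 gE] := fuss_catalanP r; rewrite -/g in g0 gE.
have Ug : g \is a GRing.unit by rewrite fps_unitE g0 oner_eq0.
have UX : 1 + fpsX \is a @GRing.unit (fps rat) by exact: fps_unit1X.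
have riordanM : is_riordan M.
  by split; rewrite /= ?g0 ?oner_eq0 ?fps_coefXM // -fps_unitE unitrXz.
split=> //.
- split; rewrite /= ?fps_coefXM // -fps_unitE ?unitrV //.
  by rewrite unitrXz.
- rewrite /riordan_inv /= fuss_catalan_compinv -/g.
  have h0 : (fpsX * g ^ r) 0%N = 0 by rewrite fps_coefXM.
  (* Substituting [h = fpsX * g ^ r] in [(1 + fpsX)^-1] and inverting gives [1 + h], which is
     [g]. *)
  rewrite -[fps_comp _ _]/(fps_subst _ _ h0 _) rmorphV //= invrK.
  by rewrite rmorphD rmorph1 /= /fps_subst fps_compX // -gE.
- apply/funext => n; apply/funext => k.
  rewrite imulmx_lower; last exact: riordan_mx_lower.
  exact: fuss_catalan_mxE.
Qed.
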